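(* Let $\nu>0$ and assume $f \in C^{1,1}_\nu(\mathbb{R}^n)$. Let $\mathbf{x}_0\in\mathbb{R}^n$ be a fixed vector and $\Theta=\{\mathbf{x}_1,\dots,\mathbf{x}_{n+1}\}\subset\mathbb{R}^n$ a fixed set of $n+1$ affinely independent vectors. Let $\hat f$ be the affine function that interpolates $f$ on $\Theta$. Then for all $\mathbf{u}\in\mathbb{R}^n$, $$|\hat f(\mathbf{x}_0)-f(\mathbf{x}_0)|\le \frac{\nu}{2}\sum_{i=0}^{n+1}|\ell_i(\mathbf{x}_0)|\,\|\mathbf{x}_i-\mathbf{u}\|^2 .$$
   Context: $\|\cdot\|$ is the Euclidean norm. $C^{1,1}_\nu(\mathbb{R}^n)$ is the class of continuously differentiable functions $f:\mathbb{R}^n\to\mathbb{R}$ whose derivative satisfies $\|Df(\mathbf{u})-Df(\mathbf{v})\|\le\nu\|\mathbf{u}-\mathbf{v}\|$ for all $\mathbf{u},\mathbf{v}\in\mathbb{R}^n$. The interpolating affine function $\hat f$ is the unique affine function with $\hat f(\mathbf{x}_i)=f(\mathbf{x}_i)$ for $i=1,\dots,n+1$. For $i=1,\dots,n+1$, $\ell_i$ is the Lagrange polynomial of $\Theta$, i.e. the unique affine function $\mathbb{R}^n\to\mathbb{R}$ with $\ell_i(\mathbf{x}_j)=1$ if $j=i$ and $\ell_i(\mathbf{x}_j)=0$ if $j\ne i$ ($j=1,\dots,n+1$); additionally $\ell_0$ is the constant function $\ell_0\equiv-1$. *)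

(* Defs.v *)
From HB Require Import structures.
From mathcomp Require Import all_boot all_order all_algebra.
From mathcomp Require Import all_classical all_reals all_analysis.

Set Implicit Arguments.
Unset Strict Implicit.
Unset Printing Implicit Defensive.

Import Order.TTheory GRing.Theory Num.Theory.
Import numFieldNormedType.Exports.

Local Open Scope ring_scope.

Definition dot (R : realType) (n : nat) (u v : 'rV[R]_n) : R :=
  \sum_(j < n) u 0 j * v 0 j.

(* The norm `|u| that the library puts on 'rV[R]_n is the maximum norm, so the
   Euclidean norm is a separate function; both induce the same topology, hence
   the same notions of differentiability and continuity. *)
Definition enorm (R : realType) (n : nat) (u : 'rV[R]_n) : R :=
  Num.sqrt (dot u u).

(* Df(u), i.e. the differential 'd f u written as the row vector of its values
   on the canonical basis. *)
Definition Df (R : realType) (n : nat) (f : 'rV[R]_n -> R) (u : 'rV[R]_n) :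
    'rV[R]_n :=
  \row_(j < n) 'd f u (delta_mx 0 j).

Definition C11 (R : realType) (n : nat) (nu : R) (f : 'rV[R]_n -> R) : Prop :=
  [/\ forall u, differentiable f u,
      continuous (Df f)
    & forall u v, enorm (Df f u - Df f v) <= nu * enorm (u - v)].

Definition affine_function (R : realType) (n : nat) (g : 'rV[R]_n -> R) : Prop :=
  exists (a : 'rV[R]_n) (b : R), forall z, g z = dot a z + b.

Definition affinely_independent (R : realType) (n m : nat)
    (y : 'I_m -> 'rV[R]_n) : Prop :=
  forall c : 'I_m -> R,
    \sum_(i < m) c i = 0 -> \sum_(i < m) c i *: y i = 0 -> forall i, c i = 0.

(* In the definitions below the points are x_0, ..., x_(n+1), given by a single
   family indexed by 'I_n.+2, and Theta consists of the last n+1 of them. *)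
Definition Theta (R : realType) (n : nat) (x : 'I_n.+2 -> 'rV[R]_n) :
    'I_n.+1 -> 'rV[R]_n :=
  fun i => x (lift ord0 i).

Definition affine_interpolant (R : realType) (n : nat)
    (x : 'I_n.+2 -> 'rV[R]_n) (f fhat : 'rV[R]_n -> R) : Prop :=
  affine_function fhat /\ forall i, fhat (Theta x i) = f (Theta x i).

(* ell_1, ..., ell_(n+1) are the Lagrange polynomials of Theta; they do not
   depend on x_0, and ell_0 is the constant -1. *)
Definition lagrange_polynomials (R : realType) (n : nat)
    (x : 'I_n.+2 -> 'rV[R]_n) (ell : 'I_n.+2 -> 'rV[R]_n -> R) : Prop :=
  [/\ forall z, ell ord0 z = -1,
      forall i : 'I_n.+1, affine_function (ell (lift ord0 i))
    & forall i j : 'I_n.+1, ell (lift ord0 i) (Theta x j) = (i == j)%:R].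

(* Hence the interpolant and the Lagrange polynomials exist and are unique. *)
Lemma affine_interpolation_unique_exists (R : realType) (n : nat)
    (y : 'I_n.+1 -> 'rV[R]_n) (v : 'I_n.+1 -> R) :
  affinely_independent y ->
  exists! g : 'rV[R]_n -> R, affine_function g /\ forall i, g (y i) = v i.
Proof.
move=> yind.
pose M : 'M[R]_(n.+1, n + 1) := \matrix_(i < n.+1) row_mx (y i) 1.
have ME (a : 'rV[R]_n) (b : R) i :
    (M *m (row_mx a b%:M)^T) i 0 = dot a (y i) + b.
  have -> : (M *m (row_mx a b%:M)^T) i 0 = (row i M *m (row_mx a b%:M)^T) 0 0.
    by rewrite -row_mul [RHS]mxE.
  rewrite rowK tr_row_mx mul_row_col mxE tr_scalar_mx mul1mx [X in _ + X]mxE eqxx.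
  by rewrite mulr1n mxE /dot; congr (_ + _); apply: eq_bigr => j _;
     rewrite mxE mulrC.
have Mfree : row_free M.
  rewrite -kermx_eq0; apply/eqP/row_matrixP => k; rewrite row0.
  have := mulmx_ker M => /(congr1 (row k)); rewrite row_mul row0.
  set w := row k _ => wM.
  have ws : w *m M = row_mx (\sum_i w 0 i *: y i) (\sum_i w 0 i)%:M.
    rewrite mulmx_sum_row; under eq_bigr do rewrite rowK scale_row_mx.
    rewrite raddf_sum /=; apply/rowP => j; rewrite summxE.
    case: (splitP j) => j' jE.
      have -> : j = lshift 1 j' by apply/val_inj.
      by rewrite row_mxEl summxE; apply: eq_bigr => i _; rewrite row_mxEl.
    have -> : j = rshift n j' by apply/val_inj.
    rewrite row_mxEr summxE; apply: eq_bigr => i _.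
    by rewrite row_mxEr !mxE mulr_natr ord1.
  move: wM; rewrite ws -[X in _ = X -> _]row_mx0 => /eq_row_mx [w1 w2].
  apply/rowP => i; rewrite [RHS]mxE; apply: yind => //.
  by move/matrixP: w2 => /(_ 0 0); rewrite !mxE.
have Mfull : row_full M.
  by move: Mfree; rewrite /row_free /row_full => /eqP ->; rewrite addn1.
have [B MB] := row_freeP Mfree.
have [C CM] := row_fullP Mfull.
have split_row (A : 'rV[R]_(n + 1)) : exists a b, A = row_mx a b%:M.
  exists (lsubmx A), (rsubmx A 0 0).
  by rewrite -mx11_scalar hsubmxK.
have [a [b ab]] := split_row (B *m \col_i v i)^T.
exists (fun z => dot a z + b); split.
  split; first by exists a, b.
  by move=> i; rewrite -ME -ab trmxK mulmxA MB mul1mx mxE.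
move=> g [[a' [b' gE]] gv].
suff : row_mx a b%:M = row_mx a' b'%:M.
  move=> /eq_row_mx [-> /matrixP /(_ 0 0)]; rewrite !mxE !mulr1n => ->.
  by apply/funext => z; rewrite gE.
apply: trmx_inj; rewrite -[LHS]mul1mx -[RHS]mul1mx -CM -!mulmxA.
congr (C *m _); apply/matrixP => i j; rewrite ord1 [RHS]ME -gE gv.
by rewrite -ab trmxK mulmxA MB mul1mx mxE.
Qed.

(* Main.v *)
Require Import Defs.
From mathcomp Require Import all_boot all_order all_algebra.
From mathcomp Require Import all_classical all_reals all_analysis.
From mathcomp Require Import ring lra.
Import Order.TTheory GRing.Theory Num.Theory.
Import numFieldNormedType.Exports.
Local Open Scope ring_scope.

(** Let [T] be the first-order Taylor polynomial of [f] at [u].  Both [fhat]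
    and [T] are affine, and an affine function is recovered from its values on
    [Theta] by the Lagrange polynomials ([lagrange_expansion]).  Applied to
    [fhat - T], which takes the values [f - T] on [Theta], this gives
      [fhat x_0 - T x_0 = \sum_(i >= 1) ell_i x_0 * (f x_i - T x_i)].
    Subtracting [f x_0 - T x_0], which is what the convention [ell_0 = -1]
    accounts for, turns the interpolation error into the combination
      [\sum_(i >= 0) ell_i x_0 * (f x_i - T x_i)]
    of Taylor errors.  A [nu]-Lipschitz gradient bounds each Taylor error by
    [nu / 2 * |x_i - u|^2] ([taylor1_error_bound]), and the triangle inequality
    concludes.  The point [u] is free because it enters only through [T].

    The Taylor bound reduces to one variable along the segment from [u] to [z]:
    the error has derivative of size at most [nu |z - u|^2 t] at time [t], and
    the mean value theorem integrates this linear bound. *)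

Section EuclideanProduct.
Context {R : realType} {n : nat}.
Implicit Types (a b z : 'rV[R]_n) (k : R).

Lemma dotDl a b z : dot (a + b) z = dot a z + dot b z.
Proof. by rewrite -big_split; apply: eq_bigr => j _; rewrite !mxE mulrDl. Qed.

Lemma dotZl k a z : dot (k *: a) z = k * dot a z.
Proof. by rewrite mulr_sumr; apply: eq_bigr => j _; rewrite !mxE mulrA. Qed.

Lemma dotC a b : dot a b = dot b a.
Proof. by apply: eq_bigr => j _; rewrite mulrC. Qed.

Lemma dotBl a b z : dot (a - b) z = dot a z - dot b z.
Proof. by rewrite dotDl -[- b]scaleN1r dotZl mulN1r. Qed.

Lemma dotBr z a b : dot z (a - b) = dot z a - dot z b.
Proof. by rewrite !(dotC z) dotBl. Qed.

Lemma dot_ge0 a : 0 <= dot a a.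
Proof. by apply: sumr_ge0 => j _; rewrite -expr2 sqr_ge0. Qed.

Lemma enorm_sqr a : enorm a ^+ 2 = dot a a.
Proof. by rewrite sqr_sqrtr ?dot_ge0. Qed.

Lemma enormZ k a : enorm (k *: a) = `|k| * enorm a.
Proof.
by rewrite /enorm dotZl dotC dotZl mulrA -expr2 sqrtrM ?sqr_ge0 // sqrtr_sqr.
Qed.

(** A weak form of Cauchy-Schwarz: expand [0 <= |a - k b|^2], bound [|a|^2] by
    [k^2 |b|^2] and divide by [2 k]. *)
Lemma dot_le_scaled_norm k a b :
  0 < k -> enorm a <= k * enorm b -> dot a b <= k * enorm b ^+ 2.
Proof.
move=> k0 ab.
have a_sqr : dot a a <= k ^+ 2 * dot b b.
  rewrite -!enorm_sqr -exprMn; apply: lerXn2r => //; rewrite nnegrE ?sqrtr_ge0 //.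
  by rewrite mulr_ge0 ?sqrtr_ge0 // ltW.
have := dot_ge0 (a - k *: b).
rewrite dotBl !dotBr !(dotC _ (k *: b)) !dotZl (dotC b a) (dotC b (k *: b)).
rewrite dotZl enorm_sqr => kab.
have : 0 <= 2 * k * (k * dot b b - dot a b) by nra.
by rewrite pmulr_rge0 ?mulr_gt0 // subr_ge0.
Qed.

Lemma norm_dot_le_scaled_norm k a b :
  0 < k -> enorm a <= k * enorm b -> `|dot a b| <= k * enorm b ^+ 2.
Proof.
move=> k0 ab; rewrite ler_norml lerNl -mulN1r -dotZl.
by rewrite !dot_le_scaled_norm // enormZ normrN1 mul1r.
Qed.

End EuclideanProduct.

(** Stands in for the integral of [dphi] over [0, 1]: subtracting the
    primitive [K / 2 * t^2] of the bound leaves a function whose derivative is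
    nonpositive on ]0, 1[, and the mean value theorem applies to it. *)
Lemma increment_le_of_linear_derivative (R : realType) (phi dphi : R -> R)
    (K : R) :
  (forall t : R, is_derive t 1 phi (dphi t)) ->
  (forall t, 0 < t -> dphi t <= K * t) ->
  phi 1 - phi 0 <= K / 2.
Proof.
move=> phiD dphi_le.
pose psi t := phi t - (K / 2) * t ^+ 2.
have psiD t : is_derive t (1 : R) psi (dphi t - K * t).
  have := phiD t => phiDt.
  apply: is_derive_eq.
  by rewrite /GRing.scale /=; field.
have psi_cont : {within `[0, 1], continuous psi}%classic.
  apply: derivable_within_continuous => t _.
  by have [] := psiD t.
have [c] := @MVT _ psi _ 0 1 ltr01 (fun t _ => psiD t) psi_cont.
rewrite in_itv /= => /andP [c0 _]; rewrite subr0 mulr1 /psi.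
have := dphi_le c c0.
rewrite expr0n expr1n /=; lra.
Qed.

Lemma norm_increment_le_of_linear_derivative (R : realType)
    (phi dphi : R -> R) (K : R) :
  (forall t : R, is_derive t 1 phi (dphi t)) ->
  (forall t, 0 < t -> `|dphi t| <= K * t) ->
  `|phi 1 - phi 0| <= K / 2.
Proof.
move=> phiD dphi_le; rewrite ler_norml lerNl opprB; apply/andP; split.
  have := @increment_le_of_linear_derivative _
    (fun t => - phi t) (fun t => - dphi t) K.
  rewrite /= opprK addrC; apply=> t t0.
  by have := dphi_le t t0; rewrite ler_norml lerNl => /andP [].
apply: increment_le_of_linear_derivative => t t0.
exact: le_trans (ler_norm _) (dphi_le t t0).
Qed.

Section LipschitzGradient.
Context {R : realType} {n : nat}.
Implicit Types (f : 'rV[R]_n -> R) (u d z : 'rV[R]_n).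

Lemma diff_dot_Df f u d : 'd f u d = dot (Df f u) d.
Proof.
rewrite [d in LHS]row_sum_delta linear_sum /=; apply: eq_bigr => j _.
by rewrite linearZ /= mxE mulrC.
Qed.

(** The difference quotients of [s |-> f (u + s d)] at [t] are those of [f] at
    [u + t d] in the direction [d], so no chain rule is involved. *)
Lemma is_derive_along_line f u d (t : R) :
  differentiable f (u + t *: d) ->
  is_derive t 1 (fun s => f (u + s *: d)) (dot (Df f (u + t *: d)) d).
Proof.
move=> fdiff; rewrite -diff_dot_Df -deriveE //.
have quotientE : (fun h : R => h^-1 *: (f (u + (h *: 1 + t) *: d)
                                        - f (u + t *: d))) =
  (fun h => h^-1 *: (f (h *: d + (u + t *: d)) - f (u + t *: d))).
  apply/funext => h; congr (_ *: (f _ - _)).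
  by rewrite [h *: 1]mulr1 scalerDl addrCA.
have fder : derivable f (u + t *: d) d by apply: diff_derivable.
split.
  by rewrite /derivable /= quotientE.
by rewrite /derive /= quotientE.
Qed.

(** Along [t |-> u + t d] with [d = z - u], the error of the linearization has
    derivative [(Df (u + t d) - Df u) . d], and the Lipschitz bound on [Df]
    makes it at most [nu |d|^2 t] in absolute value. *)
Lemma taylor1_error_bound (nu : R) f u z :
  0 < nu -> C11 nu f ->
  `|f z - (f u + dot (Df f u) (z - u))| <= nu / 2 * enorm (z - u) ^+ 2.
Proof.
move=> nu0 [fdiff _ fLip]; set d := z - u.
have phiD t := @is_derive_along_line f u d t (fdiff _).
have uz : u + 1 *: d = z by rewrite scale1r addrC subrK.
have u0 : u + 0 *: d = u by rewrite scale0r addr0.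
have linD (k t : R) : is_derive t 1 (fun s : R => k * s) k.
  by apply: is_derive_eq; rewrite /GRing.scale /= mulr1.
have := @norm_increment_le_of_linear_derivative _
  (fun t => f (u + t *: d) - dot (Df f u) d * t)
  (fun t => dot (Df f (u + t *: d)) d - dot (Df f u) d)
  (nu * enorm d ^+ 2).
rewrite /= uz u0.
have -> : f z - dot (Df f u) d * 1 - (f u - dot (Df f u) d * 0)
  = f z - (f u + dot (Df f u) d) by ring.
rewrite [nu / 2 * _]mulrAC; apply=> t t0.
rewrite -dotBl mulrAC; apply: norm_dot_le_scaled_norm; first exact: mulr_gt0.
apply: le_trans (fLip _ _) _.
by rewrite addrAC subrr add0r enormZ (gtr0_norm t0) mulrA.
Qed.

End LipschitzGradient.

Section LagrangeExpansion.
Context {R : realType} {n : nat}.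
Implicit Types (g h : 'rV[R]_n -> R).

Lemma affine_functionB g h :
  affine_function g -> affine_function h ->
  affine_function (fun z => g z - h z).
Proof.
move=> [a [b gE]] [a' [b' hE]]; exists (a - a'), (b - b') => z.
by rewrite gE hE dotBl; ring.
Qed.

Lemma affine_function_sum m (c : 'I_m -> R) (g : 'I_m -> 'rV[R]_n -> R) :
  (forall i, affine_function (g i)) ->
  affine_function (fun z => \sum_(i < m) c i * g i z).
Proof.
elim: m c g => [|m IHm] c g g_aff.
  exists 0, 0 => z; rewrite big_ord0 addr0 /dot.
  by rewrite big1 // => j _; rewrite mxE mul0r.
have [a [b sumE]] := IHm (fun i => c (lift ord0 i)) _ (fun i => g_aff (lift ord0 i)).
have [a' [b' gE]] := g_aff ord0.
exists (c ord0 *: a' + a), (c ord0 * b' + b) => z.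
by rewrite big_ord_recl sumE gE dotDl dotZl; ring.
Qed.

(** Both sides are affine functions of [z] with the same values on [Theta], so
    they agree by uniqueness of affine interpolation. *)
Lemma lagrange_expansion (x : 'I_n.+2 -> 'rV[R]_n)
    (ell : 'I_n.+2 -> 'rV[R]_n -> R) g :
  affinely_independent (Theta x) -> lagrange_polynomials x ell ->
  affine_function g ->
  forall z, g z = \sum_(i < n.+1) g (Theta x i) * ell (lift ord0 i) z.
Proof.
move=> indep [_ ell_aff ellE] g_aff z.
have [g0 [_ g0_unique]] :=
  affine_interpolation_unique_exists (fun i => g (Theta x i)) indep.
rewrite -[LHS](congr1 (@^~ z) (g0_unique g _)); last by [].
rewrite (g0_unique (fun z => \sum_(i < n.+1)
  g (Theta x i) * ell (lift ord0 i) z)) //; split.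
  exact: affine_function_sum.
move=> j; rewrite (bigD1 j) //= ellE eqxx mulr1 big1 ?addr0 // => i ij.
by rewrite ellE (negbTE ij) mulr0.
Qed.

End LagrangeExpansion.

Theorem theorem4p1 (R : realType) (n : nat) (nu : R)
    (f fhat : 'rV[R]_n -> R) (x : 'I_n.+2 -> 'rV[R]_n)
    (ell : 'I_n.+2 -> 'rV[R]_n -> R)
    (nu_gt0 : 0 < nu) (f_C11 : C11 nu f)
    (Theta_indep : affinely_independent (Theta x))
    (fhat_interp : affine_interpolant x f fhat)
    (ell_lagrange : lagrange_polynomials x ell)
    (u : 'rV[R]_n) :
  `|fhat (x ord0) - f (x ord0)|
    <= nu / 2 * \sum_(i < n.+2) `|ell i (x ord0)| * enorm (x i - u) ^+ 2.
Proof.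
have [fhat_aff fhatE] := fhat_interp; have [ell0 _ _] := ell_lagrange.
pose T z := f u + dot (Df f u) (z - u).
have T_aff : affine_function T.
  by exists (Df f u), (f u - dot (Df f u) u) => z; rewrite /T dotBr; ring.
have errorE : fhat (x ord0) - f (x ord0)
    = \sum_(i < n.+2) ell i (x ord0) * (f (x i) - T (x i)).
  rewrite big_ord_recl ell0.
  have := @lagrange_expansion _ _ x ell (fun z => fhat z - T z)
    Theta_indep ell_lagrange (affine_functionB _ _ fhat_aff T_aff) (x ord0).
  rewrite /= (eq_bigr (fun i => ell (lift ord0 i) (x ord0)
    * (f (x (lift ord0 i)) - T (x (lift ord0 i))))) => [<-|i _]; first by ring.
  by rewrite fhatE mulrC.
rewrite errorE mulr_sumr; apply: le_trans (ler_norm_sum _ _ _) _.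
apply: ler_sum => i _; rewrite normrM mulrCA ler_wpM2l //.
exact: taylor1_error_bound.
Qed.
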